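(* Let $1<p<\infty$, $m>1$, and let $\Omega\subset\mathbb{R}^2$ be a bounded domain whose singularity at the origin is of the form $|y|<x^m$, i.e. there is $\delta>0$ such that $$\Omega\cap B_\delta(0)=\{(x,y)\in\mathbb{R}^2:\ x>0,\ |y|<x^m\}\cap B_\delta(0).$$ Let $$\alpha\in\left(\frac{-m-1}{p},\ \frac{-m-1}{p}+m-1\right]$$ and let $f\in\overline{L^p(\Omega)}$ satisfy $f(x,y)\simeq x^\alpha$ near the origin. Then there is no $\mathbf{u}\in (W^{1,p}_0(\Omega))^2$ with $\operatorname{div}\mathbf{u}=f$ a.e. in $\Omega$.
   Context: $B_\delta(0)$ is the open ball of radius $\delta$ centered at the origin. $\overline{L^p(\Omega)}:=\{f\in L^p(\Omega):\int_\Omega f\,dx=0\}$. $W^{1,p}_0(\Omega)$ is the closure of the smooth functions compactly supported in $\Omega$ in the $W^{1,p}$ norm. The notation $f(x,y)\simeq\psi(x)$ near the origin, for a positive function $\psi$ on a right neighborhood of $0$, means that the ratio $f(x,y)/\psi(x)$ has an (essential) limit in $(0,\infty)$ as $(x,y)\to(0,0)$ in $\Omega$: there is $c\in(0,\infty)$ such that for every $\varepsilon>0$ there is $\eta>0$ with $|f(x,y)/\psi(x)-c|\le\varepsilon$ for a.e. $(x,y)\in\Omega\cap B_\eta(0)$. *)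

(* Defs.v *)
From HB Require Import structures.
From mathcomp Require Import all_boot all_order all_algebra.
From mathcomp Require Import all_classical all_reals all_analysis.
Set Implicit Arguments.
Unset Strict Implicit.
Unset Printing Implicit Defensive.
Import Order.TTheory GRing.Theory Num.Theory.
Import numFieldNormedType.Exports.
Local Open Scope classical_set_scope.
Local Open Scope ring_scope.

Section Sobolev.
Context {R : realType}.
Implicit Types (O : set (R * R)) (p : R).

(* R * R with the Borel sigma-algebra on which lebesgue_measure \x
   lebesgue_measure is declared. *)
Local Notation plane := (measurableTypeR R * measurableTypeR R)%type.

Definition leb2 : {measure set plane -> \bar R} :=
  (@lebesgue_measure R \x @lebesgue_measure R)%E.

(* The library's ball on R * R is a square; this is the Euclidean disc. *)
Definition disc0 (r : R) : set (R * R) :=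
  [set z | Num.sqrt (z.1 ^+ 2 + z.2 ^+ 2) < r].

Definition is_domain O := [/\ O !=set0, open O & connected O].

Definition Lp_norm O p (f : R * R -> R) : \bar R :=
  ('N[leb2]_p%:E[EFin \o (f \_ O)])%E.

Definition Lp O p : set (R * R -> R) :=
  [set f | measurable_fun (O : set plane) (f : plane -> R) /\
           (Lp_norm O p f < +oo)%E].

Definition Lp_mean0 O p : set (R * R -> R) :=
  [set f | Lp O p f /\ (\int[leb2]_(z in O) (f z)%:E = 0)%E].

Definition e1 : R * R := (1, 0).
Definition e2 : R * R := (0, 1).

(* [iter_deriv [:: v1; ...; vk] phi] is D_v1 (... (D_vk phi)). *)
Definition iter_deriv (s : seq (R * R)) (phi : R * R -> R) : R * R -> R :=
  foldr (fun v g => 'D_v g) phi s.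

(* C^infty: all iterated partial derivatives, of any order and in any order of
   the variables, exist and are continuous. *)
Definition smooth (phi : R * R -> R) :=
  forall s : seq (R * R), all (mem [:: e1; e2]) s ->
    continuous (iter_deriv s phi) /\
    forall z, derivable (iter_deriv s phi) z e1 /\
              derivable (iter_deriv s phi) z e2.

(* C_c^infty(O), each function being extended by 0 to the whole plane. *)
Definition test_fun O : set (R * R -> R) :=
  [set phi | let supp := closure [set z | phi z != 0] in
             [/\ smooth phi, compact supp & supp `<=` O]].

Definition weak_deriv O (v : R * R) (u g : R * R -> R) :=
  forall phi, test_fun O phi ->
    \int[leb2]_(z in O) (u z * 'D_v phi z) =
    - \int[leb2]_(z in O) (g z * phi z).

(* Elements of W^{1,p}(O). An element carries representatives of its weak
   partial derivatives; these are determined a.e. by the function, so they add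
   no information. *)
Record W1p O p := {
  W1p_fun :> R * R -> R;
  W1p_dx : R * R -> R;
  W1p_dy : R * R -> R;
  W1p_fun_Lp : Lp O p W1p_fun;
  W1p_dx_Lp : Lp O p W1p_dx;
  W1p_dy_Lp : Lp O p W1p_dy;
  W1p_dxP : weak_deriv O e1 W1p_fun W1p_dx;
  W1p_dyP : weak_deriv O e2 W1p_fun W1p_dy }.

(* The W^{1,p}(O) norm of u - phi, for phi a test function, whose weak
   derivatives are its classical ones. *)
Definition W1p_dist O p (u : W1p O p) (phi : R * R -> R) : \bar R :=
  (Lp_norm O p (u \- phi)%R
   + Lp_norm O p (W1p_dx u \- 'D_e1 phi)%R
   + Lp_norm O p (W1p_dy u \- 'D_e2 phi)%R)%E.

Definition W1p0 O p : set (W1p O p) :=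
  [set u | forall eps : R, 0 < eps ->
     exists2 phi, test_fun O phi & (W1p_dist u phi < eps%:E)%E].

Definition divergence O p (u : W1p O p * W1p O p) : R * R -> R :=
  W1p_dx u.1 \+ W1p_dy u.2.

(* f(x,y) ~= psi(x) near the origin: f / psi has a positive finite essential
   limit at 0 in O. *)
Definition asymp_origin O (f : R * R -> R) (psi : R -> R) :=
  exists2 c : R, 0 < c &
    forall eps : R, 0 < eps -> exists2 eta : R, 0 < eta &
      {ae leb2, forall z, (O `&` disc0 eta) z -> `|f z / psi z.1 - c| <= eps}.

End Sobolev.

(* Main.v *)
Require Import Defs.
From HB Require Import structures.
From mathcomp Require Import all_boot all_order all_algebra.
From mathcomp Require Import all_classical all_reals all_analysis.
From mathcomp Require Import measurable_realfun ring lra.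
Import Order.TTheory GRing.Theory Num.Theory.
Import numFieldNormedType.Exports.
Local Open Scope classical_set_scope.
Local Open Scope ring_scope.

(** Near the tip, [Omega] is so thin that a field vanishing on its boundary
cannot carry the flux that [f] produces there.  Fix a small [r], put
[h = r ^ m], and let [D] be the part of [Omega] in the rectangle
[[0, r] x [-h, h]], that is, the tip [0 < x <= r] of the cusp.  Among the four
sides of the rectangle, only [x = r] meets [Omega].  For test functions [phi]
and [psi], the field [((r - x) * phi, (r - x) * psi + y * phi)] therefore has
zero flux through the boundary of the rectangle: the factor [r - x] takes care
of the side [x = r].  Its divergence is
[(r - x) * div (phi, psi) + y * dy phi], because the two terms in [phi] itself
cancel.  By density, every [u] in the closure of the test functions satisfies
[\int_D ((r - x) * div u + y * dy u_1) = 0] ([W1p0_rect_identity]).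

Suppose [div u = f], where [f] behaves like [c * x ^ alpha].  The integral of
[(r - x) * f] over [D] is at least a constant times [r ^ (alpha + m + 2)]
([cusp_integral_ge]).  By Hoelder, the integral of [y * dy u_1] is at most
[h * |D| ^ (1 - 1/p)] times the norm of [dy u_1] in [L^p(D)]
([holder_bounded_weight]), where [|D| <= 2 * r ^ (m + 1)].  The upper bound on
[alpha] says precisely that the exponent [alpha + m + 2] does not exceed that of
[h * (r ^ (m + 1)) ^ (1 - 1/p)] ([cusp_exponents]).  Hence the norm of [dy u_1]
in [L^p(D)] stays above a positive constant as [r] tends to 0, which contradicts
the absolute continuity of the integral of [|dy u_1| ^ p]
([Lp_norm_abs_continuous]). *)

Set Implicit Arguments.
Unset Strict Implicit.
Unset Printing Implicit Defensive.

Local Notation plane R := (measurableTypeR R * measurableTypeR R)%type.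
Local Notation rect a b c d :=
  (`[a%R, b%R]%classic `*` `[c%R, d%R]%classic).

(** * Borel sets and integrals over rectangles in the plane *)

Section Plane.
Context {R : realType}.
Implicit Types (F G g phi psi : R * R -> R) (a b c d r h : R).

(** An open set is the union of the countably many open rectangles with rational
corners that it contains, so it belongs to the product sigma-algebra. *)
Lemma open_plane_measurable (O : set (R * R)) :
  open O -> measurable (O : set (plane R)).
Proof.
move=> oO.
pose B (q : rat * rat * rat * rat) : set (plane R) :=
  let: (q1, q2, q3, q4) := q in
  `]ratr q1, ratr q2[%classic `*` `]ratr q3, ratr q4[%classic.
have -> : O = \bigcup_(q in [set q | B q `<=` O]) B q.
  apply/seteqP; split => [z Oz|z [q /= qO Bz]]; last exact: qO.
  move/open_nbhs_nbhs: (conj oO Oz) => /nbhs_ballP[e /= e0 eO].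
  have near_rat (x : R) : exists q : rat * rat, [/\ x - e < ratr q.1 < x
      & x < ratr q.2 < x + e].
    have /rat_in_itvoo[q1] : x - e < x by lra.
    have /rat_in_itvoo[q2] : x < x + e by lra.
    by rewrite !in_itv /= => ? ?; exists (q1, q2).
  have [[q1 q2] /= [q1z q2z]] := near_rat z.1.
  have [[q3 q4] /= [q3z q4z]] := near_rat z.2.
  exists (q1, q2, q3, q4) => /=; last by rewrite /= !in_itv /=; split; lra.
  move=> w [/=]; rewrite !in_itv /= => w1 w2; apply: eO.
  by split; rewrite /= /ball /= ltr_norml; lra.
rewrite bigcup_mkcond; apply: countable_bigcupT_measurable => // q.
case: ifP => // _; case: q => [[[q1 q2] q3] q4].
by apply: measurableX; exact: measurable_itv.
Qed.

Lemma continuous_plane_measurable F :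
  continuous F -> measurable_fun setT (F : plane R -> R).
Proof.
move=> cF; apply: (measurability _ (RGenOpens.measurableE R)).
move=> _ [_ [a [b ->] <-]]; rewrite setTI; apply: open_plane_measurable.
by apply: open_comp => [z _|]; [exact: cF|exact: interval_open].
Qed.

Lemma rect_measurable a b c d : measurable (rect a b c d : set (plane R)).
Proof. by apply: measurableX; exact: measurable_itv. Qed.

Lemma leb2_rect a b c d : a <= b -> c <= d ->
  leb2 (rect a b c d) = ((b - a) * (d - c))%:E.
Proof.
move=> ab cd.
transitivity (lebesgue_measure `[a, b] * lebesgue_measure `[c, d])%E.
  by apply: product_measure1E; exact: measurable_itv.
have itvE (x y : R) : x <= y -> lebesgue_measure `[x, y] = (y - x)%:E.
  move=> xy; rewrite lebesgue_measure_itv /= lte_fin lt_neqAle xy andbT.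
  by case: eqVneq => [->|//]; rewrite subrr.
by rewrite !itvE.
Qed.

Lemma continuous_rect_bounded F a b c d : continuous F ->
  [bounded F z | z in rect a b c d].
Proof.
move=> cF; have /compact_bounded[M [_ FM]] : compact (F @` rect a b c d).
  apply: continuous_compact; first exact: continuous_subspaceT.
  by apply: compact_setX; exact: segment_compact.
by exists M; split; rewrite ?num_real// => r Mr z Rz; apply: FM => //; exists z.
Qed.

Lemma continuous_rect_integrable F a b c d : a <= b -> c <= d ->
  continuous F -> leb2.-integrable (rect a b c d) (EFin \o F).
Proof.
move=> ab cd cF; apply: measurable_bounded_integrable.
- exact: rect_measurable.
- by rewrite leb2_rect // ltry.
- by apply: measurable_funTS; exact: continuous_plane_measurable.
- exact: continuous_rect_bounded.
Qed.

Lemma continuous_hslice F (y : R) :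
  continuous F -> continuous (fun s : R => F (s, y)).
Proof.
move=> cF s; have ps : (t, y) @[t --> s] --> ((s, y) : R * R).
  apply: (@cvg_pair _ _ _ (nbhs s) (nbhs s) (nbhs y)).
    exact: cvg_id.
  exact: cvg_cst.
exact: (cvg_comp _ _ ps (cF (s, y))).
Qed.

Lemma continuous_vslice F (x : R) :
  continuous F -> continuous (fun s : R => F (x, s)).
Proof.
move=> cF s; have ps : (x, t) @[t --> s] --> ((x, s) : R * R).
  apply: (@cvg_pair _ _ _ (nbhs s) (nbhs x) (nbhs s)).
    exact: cvg_cst.
  exact: cvg_id.
exact: (cvg_comp _ _ ps (cF (x, s))).
Qed.

Lemma integral_derive_eq0 (g G : R -> R) a b : a < b -> continuous g ->
  (forall s, is_derive s (1 : R) G (g s)) -> G a = 0 -> G b = 0 ->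
  (\int[lebesgue_measure]_(s in `[a, b]) (g s)%:E = 0)%E.
Proof.
move=> ab cg dG Ga Gb.
have cG : continuous G.
  move=> s; apply/differentiable_continuous/derivable1_diffP.
  by have [] := dG s.
rewrite (@continuous_FTC2 _ _ G) //.
- by rewrite Ga Gb subee.
- exact: continuous_subspaceT.
- split=> [s _||]; first by have [] := dG s.
  + by apply: cvg_at_right_filter; exact: cG.
  + by apply: cvg_at_left_filter; exact: cG.
- by move=> s _; rewrite derive1E derive_val.
Qed.

(** Fubini, with the fundamental theorem of calculus on each vertical slice.
The derivative of [G] is taken slicewise, so that products of test functions with
coordinates are differentiated in one variable. *)
Lemma rect_integral_dy0 g G a b c d : a <= b -> c < d -> continuous g ->
  (forall x y : R, is_derive y (1 : R) (fun s : R => G (x, s)) (g (x, y))) ->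
  (forall x, a <= x <= b -> G (x, c) = 0 /\ G (x, d) = 0) ->
  (\int[leb2]_(z in rect a b c d) (g z)%:E = 0)%E.
Proof.
move=> ab cd cg dG G0; rewrite integral_mkcond.
have ig : leb2.-integrable setT ((EFin \o g) \_ (rect a b c d)).
  apply: (integrable_mkcond _ _).1; first exact: rect_measurable.
  exact: (continuous_rect_integrable ab (ltW cd)).
rewrite -[LHS](integral12_prod_meas1 ig).
apply: integral0_eq => x _ /=; rewrite /fubini_F.
have [xab|xab] := boolP (x \in `[a, b]); last first.
  apply: integral0_eq => y _.
  by rewrite patchE ifF// in_setX !mem_setE (negPf xab).
have [Gc Gd] := G0 x ltac:(by rewrite in_itv in xab).
rewrite -[RHS](@integral_derive_eq0 (fun s => g (x, s))
  (fun s => G (x, s)) c d) //.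
  rewrite [RHS]integral_mkcond.
  by apply: eq_integral => y _; rewrite !patchE in_setX !mem_setE xab.
exact: continuous_vslice.
Qed.

Lemma rect_integral_dx0 g G a b c d : a < b -> c <= d -> continuous g ->
  (forall x y : R, is_derive x (1 : R) (fun s : R => G (s, y)) (g (x, y))) ->
  (forall y, c <= y <= d -> G (a, y) = 0 /\ G (b, y) = 0) ->
  (\int[leb2]_(z in rect a b c d) (g z)%:E = 0)%E.
Proof.
move=> ab cd cg dG G0; rewrite integral_mkcond.
have ig : leb2.-integrable setT ((EFin \o g) \_ (rect a b c d)).
  apply: (integrable_mkcond _ _).1; first exact: rect_measurable.
  exact: (continuous_rect_integrable (ltW ab) cd).
rewrite -[LHS](integral21_prod_meas1 ig).
apply: integral0_eq => y _ /=; rewrite /fubini_G.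
have [ycd|ycd] := boolP (y \in `[c, d]); last first.
  apply: integral0_eq => x _.
  by rewrite patchE ifF// in_setX !mem_setE (negPf ycd) andbF.
have [Ga Gb] := G0 y ltac:(by rewrite in_itv in ycd).
rewrite -[RHS](@integral_derive_eq0 (fun s => g (s, y))
  (fun s => G (s, y)) a b) //.
  rewrite [RHS]integral_mkcond.
  by apply: eq_integral => x _; rewrite !patchE in_setX !mem_setE ycd andbT.
exact: continuous_hslice.
Qed.

Let diff_quot1 F (x y : R) :
  (fun h : R => h^-1 *: ((F \o shift (x, y)) (h *: e1) - F (x, y))) =
  (fun h : R =>
     h^-1 *: (((fun s : R => F (s, y)) \o shift x) (h *: 1) - F (x, y))).
Proof.
apply/funext => h /=; congr (_ *: (F _ - _)).
transitivity (h * 1 + x, h * 0 + y) => //; by rewrite mulr0 add0r.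
Qed.

Let diff_quot2 F (x y : R) :
  (fun h : R => h^-1 *: ((F \o shift (x, y)) (h *: e2) - F (x, y))) =
  (fun h : R =>
     h^-1 *: (((fun s : R => F (x, s)) \o shift y) (h *: 1) - F (x, y))).
Proof.
apply/funext => h /=; congr (_ *: (F _ - _)).
transitivity (h * 0 + x, h * 1 + y) => //; by rewrite mulr0 add0r.
Qed.

Lemma is_derive_e1 F (x y : R) : derivable F (x, y) e1 ->
  is_derive x (1 : R) (fun s : R => F (s, y)) ('D_e1 F (x, y)).
Proof.
by move=> dF; apply: DeriveDef; rewrite /derivable /derive -diff_quot1.
Qed.

Lemma is_derive_e2 F (x y : R) : derivable F (x, y) e2 ->
  is_derive y (1 : R) (fun s : R => F (x, s)) ('D_e2 F (x, y)).
Proof.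
by move=> dF; apply: DeriveDef; rewrite /derivable /derive -diff_quot2.
Qed.

Lemma smooth_continuous_derive phi : smooth phi ->
  continuous ('D_e1 phi) /\ continuous ('D_e2 phi).
Proof.
move=> sphi; split.
  by have [] := sphi [:: e1] ltac:(by rewrite /= !inE eqxx).
by have [] := sphi [:: e2] ltac:(by rewrite /= !inE eqxx orbT).
Qed.

Lemma continuous_right_gap r : continuous (fun z : R * R => r - z.1).
Proof. by move=> z; apply: cvgB; [exact: cvg_cst|exact: cvg_fst]. Qed.

Lemma continuous_ordinate : continuous (fun z : R * R => z.2).
Proof. by move=> z; exact: cvg_snd. Qed.

(** The divergence theorem for the field
[((r - x) * phi, (r - x) * psi + y * phi)], whose flux through each of the four
sides is zero. *)
Lemma smooth_div_identity phi psi r h : 0 < r -> 0 < h ->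
  smooth phi -> smooth psi ->
  (forall x y, 0 <= x <= r -> `|y| = h -> phi (x, y) = 0 /\ psi (x, y) = 0) ->
  (forall y, `|y| <= h -> phi (0, y) = 0) ->
  (\int[leb2]_(z in rect 0 r (- h) h)
     ((r - z.1) * ('D_e1 phi z + 'D_e2 psi z) + z.2 * 'D_e2 phi z)%R%:E = 0)%E.
Proof.
move=> r0 h0 sphi spsi bnd_h bnd_0.
have [/= cphi dphi] := sphi [::] isT; have [_ /= dpsi] := spsi [::] isT.
have [cphi1 cphi2] := smooth_continuous_derive sphi.
have [_ cpsi2] := smooth_continuous_derive spsi.
have cr := @continuous_right_gap r; have cy := @continuous_ordinate.
pose g1 z := (r - z.1) * 'D_e1 phi z - phi z.
pose g2 z := (r - z.1) * 'D_e2 psi z.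
pose g3 z := phi z + z.2 * 'D_e2 phi z.
have cg1 : continuous g1.
  by move=> z; apply: cvgB; [apply: cvgM; [exact: cr|exact: cphi1]|exact: cphi].
have cg2 : continuous g2.
  by move=> z; apply: cvgM; [exact: cr|exact: cpsi2].
have cg3 : continuous g3.
  move=> z; apply: cvgD; first exact: cphi.
  by apply: cvgM; [exact: cy|exact: cphi2].
have hh : - h < h by lra.
have normh : `|h| = h /\ `|- h| = h by rewrite normrN gtr0_norm.
have I1 : (\int[leb2]_(z in rect 0 r (- h) h) (g1 z)%:E = 0)%E.
  apply: (@rect_integral_dx0 g1 (fun z => (r - z.1) * phi z)) cg1 _ _ => //.
  - exact: ltW.
  - move=> x y /=; have /is_derive_e1 dx := (dphi (x, y)).1.
    by apply: is_derive_eq; rewrite /g1 /= /GRing.scale /=; ring.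
  - by move=> y yh /=; rewrite subrr mul0r bnd_0 ?mulr0// ler_norml.
have I2 : (\int[leb2]_(z in rect 0 r (- h) h) (g2 z)%:E = 0)%E.
  apply: (@rect_integral_dy0 g2 (fun z => (r - z.1) * psi z)) cg2 _ _ => //.
  - exact: ltW.
  - move=> x y /=; have /is_derive_e2 dy := (dpsi (x, y)).2.
    by apply: is_derive_eq; rewrite /g2 /= /GRing.scale /=; ring.
  - move=> x xr /=.
    by rewrite (bnd_h x (- h) xr normh.2).2 (bnd_h x h xr normh.1).2 !mulr0.
have I3 : (\int[leb2]_(z in rect 0 r (- h) h) (g3 z)%:E = 0)%E.
  apply: (@rect_integral_dy0 g3 (fun z => z.2 * phi z)) cg3 _ _ => //.
  - exact: ltW.
  - move=> x y /=; have /is_derive_e2 dy := (dphi (x, y)).2.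
    by apply: is_derive_eq; rewrite /g3 /= /GRing.scale /=; ring.
  - move=> x xr /=.
    by rewrite (bnd_h x (- h) xr normh.2).1 (bnd_h x h xr normh.1).1 !mulr0.
have mR := rect_measurable 0 r (- h) h.
have ig g : continuous g -> leb2.-integrable (rect 0 r (- h) h) (EFin \o g).
  exact: (continuous_rect_integrable (ltW r0) (ltW hh)).
transitivity (\int[leb2]_(z in rect 0 r (- h) h)
    ((EFin \o g1) z + (EFin \o g2) z + (EFin \o g3) z))%E.
  apply: eq_integral => z _; rewrite /= -!EFinD; congr EFin.
  by rewrite /g1 /g2 /g3; ring.
rewrite integralD //; [|apply: integrableD; by [|exact: ig]|exact: ig].
by rewrite integralD ?I1 ?I2 ?I3 ?adde0//; exact: ig.
Qed.

Lemma measurable_right_gap (D : set (plane R)) r :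
  measurable_fun D (fun z : plane R => r - z.1).
Proof.
apply: measurable_funTS; apply: continuous_plane_measurable.
exact: continuous_right_gap.
Qed.

Lemma measurable_ordinate (D : set (plane R)) :
  measurable_fun D (fun z : plane R => z.2).
Proof.
apply: measurable_funTS; apply: continuous_plane_measurable.
exact: continuous_ordinate.
Qed.

Lemma rect_right_gap_le r h (z : R * R) :
  rect 0 r (- h) h z -> `|r - z.1| <= r.
Proof. by case=> /= + _; rewrite in_itv /= ler_norml; lra. Qed.

Lemma rect_ordinate_le r h (z : R * R) : rect 0 r (- h) h z -> `|z.2| <= h.
Proof. by case=> /= _; rewrite in_itv /= ler_norml. Qed.

Lemma leb2_sub_rect (D : set (plane R)) r h : 0 <= r -> 0 <= h ->
  measurable D -> D `<=` rect 0 r (- h) h -> (leb2 D <= (2 * (r * h))%R%:E)%E.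
Proof.
move=> r0 h0 mD DR; have -> : 2 * (r * h) = (r - 0) * (h - - h) by ring.
rewrite -leb2_rect//; last by lra.
by apply: le_measure; rewrite ?inE//; exact: rect_measurable.
Qed.

End Plane.

(** * Norms of L^p *)

Section Lebesgue_norm.
Context {R : realType}.
Implicit Types (D O : set (plane R)) (h w : plane R -> R) (p : R).

Lemma Lp_normE D p h : 0 < p ->
  (Lp_norm D p h = (\int[leb2]_(z in D) (`|h z| `^ p)%:E) `^ p^-1)%E.
Proof.
move=> p0; rewrite /Lp_norm unlock; apply: (f_equal (fun t => poweR t p^-1)).
rewrite [RHS]integral_mkcond; apply: eq_integral => z _ /=.
rewrite !patchE; case: ifPn => _ //=.
by rewrite [X in `|X|](_ : _ = 0 :> R)// normr0 powR0// gt_eqF.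
Qed.

Lemma measurable_norm_powR D p h : measurable_fun D h ->
  measurable_fun D (fun z => `|h z| `^ p : R).
Proof.
move=> mh.
apply: (measurableT_comp (measurable_powR p)).
exact: measurableT_comp mh.
Qed.

Lemma Lp_norm_subset D O p h : 0 < p -> measurable D -> measurable O ->
  D `<=` O -> measurable_fun O h -> (Lp_norm D p h <= Lp_norm O p h)%E.
Proof.
move=> p0 mD mO DO mh; rewrite !Lp_normE//.
have pos (E : set (plane R)) : (0 <= \int[leb2]_(z in E) (`|h z| `^ p)%:E)%E.
  by apply: integral_ge0 => z _; rewrite lee_fin powR_ge0.
apply: gt0_ler_poweR; rewrite ?invr_ge0 ?(ltW p0)// ?in_itv /= ?pos ?leey//.
apply: ge0_subset_integral => //.
by apply/measurable_EFinP; exact: measurable_norm_powR.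
Qed.

Lemma Lp_norm_fin_integrable D p h : 0 < p -> measurable_fun D h ->
  (Lp_norm D p h < +oo)%E ->
  leb2.-integrable D (EFin \o (fun z => `|h z| `^ p)).
Proof.
move=> p0 mh; rewrite Lp_normE// => fin; apply/integrableP; split.
  by apply/measurable_EFinP; exact: measurable_norm_powR.
under eq_integral do rewrite /= ger0_norm ?powR_ge0//.
by apply: lty_poweRy fin; rewrite invr_eq0 gt_eqF.
Qed.

(** Absolute continuity of the integral of [|h| ^ p], extended by zero. *)
Lemma Lp_norm_abs_continuous O p h (e : R) : 0 < p -> measurable O ->
  Lp O p h -> 0 < e ->
  exists2 d : R, 0 < d & forall D, measurable D -> D `<=` O ->
    (leb2 D < d%:E)%E -> (Lp_norm D p h <= e%:E)%E.
Proof.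
move=> p0 mO [mh hfin] e0.
have ih := Lp_norm_fin_integrable p0 mh hfin.
have iH : leb2.-integrable setT (EFin \o ((fun z => `|h z| `^ p) \_ O)).
  by rewrite -restrict_EFin; exact: (integrable_mkcond _ mO).1.
have [d [d0 dP]] := integral_normr_continuous iH (powR_gt0 p e0).
exists d => // D mD DO /(dP D mD) De; rewrite Lp_normE//.
have -> : (\int[leb2]_(z in D) (`|h z| `^ p)%:E =
    (\int[leb2]_(z in D) `|((fun z => `|h z| `^ p) \_ O) z|)%:E)%E.
  rewrite fineK; last first.
    apply: integrable_fin_num => //; apply: integrable_norm.
    by apply: integrableS iH.
  apply: eq_integral => z; rewrite inE => Dz; congr EFin.
  have /mem_set Oz := DO _ Dz.
  by rewrite patchE Oz [RHS]ger0_norm ?powR_ge0.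
have -> : e%:E = ((e `^ p)%:E `^ p^-1)%E.
  by rewrite poweR_EFin -powRrM mulfV ?gt_eqF// powRr1// ltW.
rewrite !poweR_EFin lee_fin; apply: ge0_ler_powR; rewrite ?invr_ge0 ?ltW//.
- by rewrite nnegrE Rintegral_ge0.
- by rewrite nnegrE powR_ge0.
Qed.

(** Hoelder's inequality between [h] and the indicator of [D], once the weight
[w] has been bounded by the constant [M]. *)
Lemma holder_bounded_weight D p h w (M V : R) : 1 < p -> measurable D ->
  measurable_fun D h -> measurable_fun D w -> 0 <= M ->
  (forall z, D z -> `|w z| <= M) -> (leb2 D <= V%:E)%E ->
  (\int[leb2]_(z in D) `|w z * h z|%:E <=
    (M * V `^ (1 - p^-1))%:E * Lp_norm D p h)%E.
Proof.
move=> p1 mD mh mw M0 wM DV.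
have p0 : 0 < p by lra.
have ip : 0 < p^-1 < 1 by rewrite invr_gt0 p0 invf_lt1.
pose q := (1 - p^-1)^-1.
have q0 : 0 < q by rewrite invr_gt0; lra.
have mhD : measurable_fun setT (h \_ D) by apply/(measurable_restrictT _ mD).
have mI : measurable_fun setT (\1_D : plane R -> R) by exact: measurable_indic.
have := @hoelder _ _ _ leb2 (h \_ D) (\1_D : plane R -> R) p q mhD
  (mI) p0 q0.
rewrite invrK addrC subrK => /(_ erefl).
have -> : ('N[leb2]_1[(EFin \o (h \_ D \* \1_D)%R)] =
           \int[leb2]_(z in D) `|h z|%:E)%E.
  rewrite Lnorm1 [RHS]integral_mkcond; apply: eq_integral => z _ /=.
  rewrite !patchE indicE; case: (z \in D) => /=; first by rewrite mulr1.
  by rewrite mulr0 normr0.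
have -> : ('N[leb2]_q%:E[EFin \o \1_D] = leb2 D `^ (1 - p^-1))%E.
  rewrite unlock invrK; congr (_ `^ _)%E.
  rewrite -[in RHS](setIT D) -integral_indic//; apply: eq_integral => z _ /=.
  rewrite indicE; case: (z \in D) => /=; first by rewrite normr1 powR1.
  by rewrite normr0 powR0// gt_eqF.
rewrite -/(Lp_norm D p h) => H.
apply: (@le_trans _ _ (M%:E * \int[leb2]_(z in D) `|h z|%:E)%E).
  rewrite -ge0_integralZl//; last first.
    by apply/measurable_EFinP; exact: measurableT_comp mh.
  apply: ge0_le_integral => //.
  - apply/measurable_EFinP; apply: measurableT_comp => //.
    exact: measurable_funM.
  - apply/measurable_EFinP; apply: measurable_funM => //.
    exact: measurableT_comp mh.
  - by move=> z Dz; rewrite -EFinM lee_fin normrM ler_wpM2r// wM.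
rewrite EFinM -muleA lee_wpmul2l ?lee_fin//.
rewrite (le_trans H)// muleC lee_wpmul2r ?Lnorm_ge0//.
rewrite -poweR_EFin; apply: gt0_ler_poweR => //; first lra.
- by rewrite in_itv /= measure_ge0 leey.
- by rewrite in_itv /= leey andbT (le_trans _ DV).
Qed.

Lemma bounded_weight_integrable D p h w (M V : R) : 1 < p -> measurable D ->
  measurable_fun D h -> measurable_fun D w -> 0 <= M ->
  (forall z, D z -> `|w z| <= M) -> (leb2 D <= V%:E)%E ->
  (Lp_norm D p h < +oo)%E ->
  leb2.-integrable D (EFin \o (fun z => w z * h z)).
Proof.
move=> p1 mD mh mw M0 wM DV fin; apply/integrableP; split.
  by apply/measurable_EFinP; exact: measurable_funM.
apply: le_lt_trans (holder_bounded_weight p1 mD mh mw M0 wM DV) _.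
rewrite lte_mul_pinfty// ?lee_fin ?mulr_ge0 ?powR_ge0//.
Qed.

End Lebesgue_norm.

(** * Fields in the closure of the test functions *)

Section Sobolev0.
Context {R : realType}.
Implicit Types (O : set (R * R)) (phi psi : R * R -> R) (p r h : R).

Lemma test_fun_out O phi z : test_fun O phi -> ~ O z -> phi z = 0.
Proof.
move=> [_ _ suppO] NOz; apply: contra_notP NOz => /eqP phiz.
by apply/suppO/subset_closure.
Qed.

(** The support of [phi] is a closed subset of [O], so [phi] vanishes in a
neighbourhood of [z]. *)
Lemma test_fun_derive_out O phi v z : test_fun O phi -> ~ O z -> 'D_v phi z = 0.
Proof.
move=> [_ _ suppO] NOz.
have /= Nz : (~` closure [set z | phi z != 0]) z by move=> /suppO.
have -> : 'D_v phi z = 'D_v (cst 0) z; last by rewrite derive_cst.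
apply: near_eq_derive.
have oN := closed_openC (@closed_closure _ [set z | phi z != 0]).
have := open_nbhs_nbhs (conj oN Nz).
apply: filterS => w Nw /=; apply: contra_notP Nw => /eqP phiw.
exact: subset_closure.
Qed.

Lemma W1p_dist_dx_le O p (v : W1p O p) phi :
  (Lp_norm O p (W1p_dx v \- 'D_e1 phi)%R <= W1p_dist v phi)%E.
Proof.
rewrite /W1p_dist -addeA addeCA -[leLHS]adde0.
by rewrite leeD2l// adde_ge0// Lnorm_ge0.
Qed.

Lemma W1p_dist_dy_le O p (v : W1p O p) phi :
  (Lp_norm O p (W1p_dy v \- 'D_e2 phi)%R <= W1p_dist v phi)%E.
Proof. by rewrite /W1p_dist leeDr// adde_ge0// Lnorm_ge0. Qed.

Lemma measurable_Lp_sub_continuous O p (g phi : plane R -> R) :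
  Lp O p g -> continuous (phi : R * R -> R) ->
  measurable_fun (O : set (plane R)) (g \- phi : plane R -> R).
Proof.
move=> [mg _] cphi; apply: measurable_funB => //.
by apply: measurable_funTS; exact: continuous_plane_measurable.
Qed.

Lemma abse_integral3_le (D : set (plane R)) (g1 g2 g3 : plane R -> R) (k : R) :
  measurable D -> leb2.-integrable D (EFin \o g1) ->
  leb2.-integrable D (EFin \o g2) -> leb2.-integrable D (EFin \o g3) ->
  (\int[leb2]_(z in D) `|g1 z|%:E <= k%:E)%E ->
  (\int[leb2]_(z in D) `|g2 z|%:E <= k%:E)%E ->
  (\int[leb2]_(z in D) `|g3 z|%:E <= k%:E)%E ->
  (`|\int[leb2]_(z in D) (g1 z + g2 z + g3 z)%:E| <= (3 * k)%:E)%E.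
Proof.
move=> mD i1 i2 i3 b1 b2 b3.
have i123 := integrableD mD (integrableD mD i1 i2) i3.
have mabs (g : plane R -> R) : leb2.-integrable D (EFin \o g) ->
    measurable_fun D (fun z => `|g z|%:E).
  move=> /(measurable_int _) /measurable_EFinP mg.
  by apply/measurable_EFinP; exact: measurableT_comp mg.
have m1 := mabs _ i1; have m2 := mabs _ i2; have m3 := mabs _ i3.
have m12 := emeasurable_funD m1 m2.
apply: le_trans (le_abse_integral leb2 mD (measurable_int _ i123)) _.
apply: (@le_trans _ _ (\int[leb2]_(z in D)
    (`|g1 z|%:E + `|g2 z|%:E + `|g3 z|%:E))%E).
  apply: ge0_le_integral => //.
  - exact: measurableT_comp (measurable_int _ i123).
  - exact: emeasurable_funD m12 m3.
  - move=> z _; rewrite /= -!EFinD lee_fin.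
    by rewrite (le_trans (ler_normD _ _))// lerD2r ler_normD.
rewrite (ge0_integralD leb2 mD _ m12 _ m3)//; last first.
  by move=> z _; rewrite adde_ge0.
rewrite (ge0_integralD leb2 mD _ m1 _ m2)//.
have -> : (3 * k)%:E = (k%:E + k%:E + k%:E)%E.
  by rewrite -!EFinD; congr EFin; ring.
exact: leeD (leeD b1 b2) b3.
Qed.

(** The left-hand side is continuous in [u] for the norm of [W^{1,p}].  It
vanishes on test functions by [smooth_div_identity], because these are zero,
with their derivatives, outside [O]. *)
Lemma W1p0_rect_identity O p (u : W1p O p * W1p O p) r h :
  1 < p -> open O -> 0 < r -> 0 < h ->
  (forall x y, 0 <= x <= r -> `|y| = h -> ~ O (x, y)) ->
  (forall y, `|y| <= h -> ~ O (0, y)) ->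
  W1p0 u.1 -> W1p0 u.2 ->
  (\int[leb2]_(z in rect 0 r (- h) h `&` O)
     ((r - z.1) * divergence u z + z.2 * W1p_dy u.1 z)%R%:E = 0)%E.
Proof.
move=> p1 oO r0 h0 Oh O0 u10 u20.
set D : set (plane R) := _ `&` O; set L := LHS.
have p0 : 0 < p by exact: lt_trans p1.
have mO : measurable (O : set (plane R)) := open_plane_measurable oO.
have mR := rect_measurable 0 r (- h) h.
have mD : measurable D by exact: measurableI.
have DO : D `<=` O by move=> z [].
have DR : D `<=` rect 0 r (- h) h by move=> z [].
have DV := leb2_sub_rect (ltW r0) (ltW h0) mD DR.
set V := 2 * (r * h) in DV.
have mw1 := @measurable_right_gap R D r; have mw2 := @measurable_ordinate R D.
have M0 : 0 <= r + h by rewrite addr_ge0 ?ltW.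
have M1 z : D z -> `|r - z.1| <= r + h.
  by move=> /DR/rect_right_gap_le/le_trans; apply; rewrite lerDl ltW.
have M2 z : D z -> `|z.2| <= r + h.
  by move=> /DR/rect_ordinate_le/le_trans; apply; rewrite lerDr ltW.
pose K := (r + h) * V `^ (1 - p^-1).
have K0 : 0 <= K by rewrite mulr_ge0 ?powR_ge0.
suff LK (e : R) : 0 < e -> (`|L| <= (3 * (K * e))%:E)%E.
  apply/eqP; rewrite -abse_eq0 eq_le abse_ge0 andbT.
  apply/lee_addgt0Pr => e e0; rewrite add0e.
  have K1 : 0 < 3 * K + 1 by rewrite ltr_wpDl// mulr_ge0.
  apply: le_trans (LK (e / (3 * K + 1)) _) _; first by rewrite divr_gt0.
  have -> : 3 * (K * (e / (3 * K + 1))) = 3 * K / (3 * K + 1) * e.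
    by move: (3 * K + 1)^-1 => k; ring.
  rewrite lee_fin.
  by rewrite ler_piMl ?(ltW e0)// ler_pdivrMr// mul1r lerDl.
move=> e0.
have [phi tphi dphi] := u10 _ e0.
have [psi tpsi dpsi] := u20 _ e0.
pose H1 : plane R -> R := W1p_dx u.1 \- 'D_e1 phi.
pose H2 : plane R -> R := W1p_dy u.2 \- 'D_e2 psi.
pose H3 : plane R -> R := W1p_dy u.1 \- 'D_e2 phi.
have [sphi _ _] := tphi; have [spsi _ _] := tpsi.
have [cphi1 cphi2] := smooth_continuous_derive sphi.
have [_ cpsi2] := smooth_continuous_derive spsi.
have mH1 : measurable_fun O H1 :=
  measurable_Lp_sub_continuous (W1p_dx_Lp u.1) cphi1.
have mH2 : measurable_fun O H2 :=
  measurable_Lp_sub_continuous (W1p_dy_Lp u.2) cpsi2.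
have mH3 : measurable_fun O H3 :=
  measurable_Lp_sub_continuous (W1p_dy_Lp u.1) cphi2.
have N1 : (Lp_norm O p H1 < e%:E)%E := le_lt_trans (W1p_dist_dx_le _ _) dphi.
have N2 : (Lp_norm O p H2 < e%:E)%E := le_lt_trans (W1p_dist_dy_le _ _) dpsi.
have N3 : (Lp_norm O p H3 < e%:E)%E := le_lt_trans (W1p_dist_dy_le _ _) dphi.
have bound (w H : plane R -> R) :
    measurable_fun O H -> (Lp_norm O p H < e%:E)%E ->
    measurable_fun D w -> (forall z, D z -> `|w z| <= r + h) ->
    leb2.-integrable D (EFin \o (fun z => w z * H z)) /\
    (\int[leb2]_(z in D) `|w z * H z|%:E <= (K * e)%:E)%E.
  move=> mHO NH mw wM.
  have mHD : measurable_fun D H by exact: measurable_funS mHO.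
  have ND : (Lp_norm D p H <= e%:E)%E.
    by rewrite (le_trans (Lp_norm_subset p0 mD mO DO mHO))// ltW.
  split.
    apply: (bounded_weight_integrable p1 mD mHD mw M0 wM DV).
    exact: le_lt_trans ND (ltry _).
  apply: le_trans (holder_bounded_weight p1 mD mHD mw M0 wM DV) _.
  by rewrite (EFinM K e) lee_wpmul2l// lee_fin.
have [i1 b1] := bound _ _ mH1 N1 mw1 M1.
have [i2 b2] := bound _ _ mH2 N2 mw1 M1.
have [i3 b3] := bound _ _ mH3 N3 mw2 M2.
pose G (z : R * R) :=
  (r - z.1) * ('D_e1 phi z + 'D_e2 psi z) + z.2 * 'D_e2 phi z.
have cG : continuous G.
  move=> z; apply: cvgD; apply: cvgM.
  - exact: continuous_right_gap.
  - by apply: cvgD; [exact: cphi1|exact: cpsi2].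
  - exact: continuous_ordinate.
  - exact: cphi2.
have hh : - h <= h by rewrite ge0_cp ?ltW.
have iG : leb2.-integrable D (EFin \o G).
  apply: (integrableS mR) => //.
  exact: (continuous_rect_integrable (ltW r0) hh cG).
have G0 : (\int[leb2]_(z in D) (G z)%:E = 0)%E.
  rewrite -[RHS](smooth_div_identity r0 h0 sphi spsi).
  - rewrite integral_mkcondr; apply: eq_integral => z _.
    rewrite patchE; case: ifPn => // /negP; rewrite inE => NOz.
    by rewrite !(test_fun_derive_out _ tphi NOz)
      (test_fun_derive_out _ tpsi NOz) addr0 !mulr0 addr0.
  - move=> x y xr yh; have NO := Oh x y xr yh.
    by rewrite (test_fun_out tphi NO) (test_fun_out tpsi NO).
  - by move=> y yh; rewrite (test_fun_out tphi (O0 y yh)).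
pose S z := (r - z.1) * H1 z + (r - z.1) * H2 z + z.2 * H3 z.
have iS : leb2.-integrable D (EFin \o S).
  exact: (integrableD mD (integrableD mD i1 i2) i3).
have -> : (L = \int[leb2]_(z in D) (S z)%:E)%E.
  rewrite -[RHS]adde0 -[X in (_ + X)%E]G0 -integralD//.
  apply: eq_integral => z _ /=; rewrite -EFinD; congr EFin.
  rewrite /S /G /H1 /H2 /H3 /divergence /=.
  by move: (W1p_dx _ z) (W1p_dy _ z) (W1p_dy _ z) ('D_e1 _ z) ('D_e2 _ z)
    ('D_e2 _ z) => ? ? ? ? ? ?; ring.
exact: abse_integral3_le i1 i2 i3 b1 b2 b3.
Qed.

End Sobolev0.

(** * Estimates at the tip of the cusp *)

Section Cusp.
Context {R : realType}.
Implicit Types (O : set (R * R)) (p m c r alpha : R).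

Lemma disc0_square (d r x y : R) :
  `|x| <= r -> `|y| <= r -> 2 * r < d -> disc0 d (x, y).
Proof.
move=> xr yr rd; have r0 : 0 <= r by exact: le_trans xr.
rewrite /disc0 /= -[ltRHS]ger0_norm; last by lra.
rewrite -sqrtr_sqr ltr_sqrt ?exprn_gt0//; last by lra.
have sq t : `|t| <= r -> t ^+ 2 <= r ^+ 2.
  by move=> tr; rewrite -[leLHS]real_normK ?num_real// ler_pXn2r ?nnegrE.
have := sq _ xr; have := sq _ yr.
have : (2 * r) ^+ 2 < d ^+ 2 by rewrite ltr_pXn2r ?nnegrE//; lra.
rewrite exprMn; nra.
Qed.

(** The exponent [`|alpha|] covers both signs of [alpha]: on [[1/4, 1]],
[t ^ alpha >= t ^ |alpha| >= 4 ^ - |alpha|]. *)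
Lemma powR_interval_ge alpha r x : 0 < r -> r / 4 <= x <= r / 2 ->
  4^-1 `^ `|alpha| * r `^ alpha <= x `^ alpha.
Proof.
move=> r0 xr; have -> : x = x / r * r by rewrite divfK// gt_eqF.
have tl : 4^-1 <= x / r by rewrite ler_pdivlMr//; lra.
have tu : x / r <= 1 by rewrite ler_pdivrMr//; lra.
rewrite powRM ?(ltW r0)//; last by lra.
rewrite ler_wpM2r ?powR_ge0//.
apply: (@le_trans _ _ ((x / r) `^ `|alpha|)).
  by apply: ge0_ler_powR; rewrite ?nnegrE//; lra.
by apply: ger_powR; [lra|exact: ler_norm].
Qed.

(** [h * |D| ^ (1 - 1/p) <= 2 * r ^ (alpha + m + 2)] for [h = r ^ m] and
[|D| = 2 * r * h].  For [r <= 1] this is a comparison of exponents,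
[alpha + m + 2 <= m + (1 + m) * (1 - 1/p)], which is the assumed upper bound on
[alpha]. *)
Lemma cusp_exponents p m alpha r : 1 < p -> 1 < m -> 0 < r <= 1 ->
  alpha <= (- m - 1) / p + m - 1 ->
  r `^ m * (2 * (r * r `^ m)) `^ (1 - p^-1) <=
    2 * (r `^ 2 * r `^ alpha * r `^ m).
Proof.
move=> p1 m1 /andP[r0 r1] am.
have ip : 0 < p^-1 < 1 by rewrite invr_gt0 invf_lt1; lra.
have rN0 (s : R) : (s == 0) ==> (r != 0) by rewrite (gt_eqF r0) implybT.
have rr : r * r `^ m = r `^ (1 + m) by rewrite powRD ?powRr1 ?ltW.
have H2 : 2 `^ (1 - p^-1) <= 2 :> R.
  by rewrite -[leRHS]powRr1//; apply: ler_powR; lra.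
rewrite rr powRM ?powR_ge0// -powRrM mulrCA.
rewrite -!powRD//; apply: ler_pM; rewrite ?powR_ge0//.
apply: ger_powR; first by rewrite r0.
move: am; rewrite mulrDl mulNr; lra.
Qed.

(** It is enough to integrate over the block [[r/4, r/2] x [-s, s]] with
[s = (r/8) ^ m], where [r - x >= r/2] and [x ^ alpha] is at least a multiple of
[r ^ alpha]; the block has area [(r/4) * 2 * s]. *)
Lemma cusp_integral_ge (D : set (plane R)) (f : plane R -> R) m alpha c r :
  measurable D -> measurable_fun D f -> 0 < c -> 0 < r ->
  rect (r / 4) (r / 2) (- (r / 8) `^ m) ((r / 8) `^ m) `<=` D ->
  (forall z, D z -> 0 <= r - z.1) ->
  {ae leb2, forall z, D z -> c * z.1 `^ alpha <= f z} ->
  ((c * 4^-1 `^ `|alpha| * 8^-1 `^ m / 4 * (r `^ 2 * r `^ alpha * r `^ m))%:E <=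
    \int[leb2]_(z in D) ((r - z.1) * f z)%:E)%E.
Proof.
move=> mD mf c0 r0 SD wD fD.
set S := (X in X `<=` D) in SD.
set k := 4^-1 `^ `|alpha|.
have s0 : 0 <= (r / 8) `^ m := powR_ge0 _ _.
have mS : measurable (S : set (plane R)) by exact: rect_measurable.
have mw := @measurable_right_gap R D r.
have mwf : measurable_fun D (fun z => (r - z.1) * f z).
  exact: measurable_funM.
have mawf : measurable_fun D (fun z => `|(r - z.1) * f z| : R).
  exact: measurableT_comp mwf.
have -> : (\int[leb2]_(z in D) ((r - z.1) * f z)%:E =
           \int[leb2]_(z in D) `|(r - z.1) * f z|%:E)%E.
  apply: ae_eq_integral => //; [exact/measurable_EFinP..|].
  apply: filterS fD => z fz Dz; rewrite ger0_norm// mulr_ge0 ?wD//.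
  by rewrite (le_trans _ (fz Dz))// mulr_ge0 ?powR_ge0// ltW.
pose kap := r / 2 * (c * (k * r `^ alpha)).
apply: (@le_trans _ _ (\int[leb2]_(z in S) kap%:E)%E).
  rewrite integral_cst// /S leb2_rect; [|lra..].
  rewrite lee_fin /kap.
  rewrite (@powRM _ r 8^-1) ?(ltW r0)// powR_mulrn; last exact: ltW.
  by rewrite le_eqVlt; apply/orP; left; apply/eqP; field.
apply: (@le_trans _ _ (\int[leb2]_(z in S) `|(r - z.1) * f z|%:E)%E).
  apply: ae_ge0_le_integral => //.
  - by move=> z _; rewrite lee_fin !mulr_ge0 ?powR_ge0 ?divr_ge0// ltW.
  - by apply/measurable_EFinP; exact: measurable_funS mawf.
  apply: filterS fD => z fz Sz; rewrite lee_fin.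
  have zr : r / 4 <= z.1 <= r / 2 by case: Sz => /= + _; rewrite in_itv.
  rewrite (le_trans _ (ler_norm _))// /kap.
  apply: ler_pM; [lra|by rewrite !mulr_ge0 ?powR_ge0// ltW|lra|].
  apply: le_trans (fz (SD _ Sz)); rewrite ler_pM2l//.
  exact: powR_interval_ge.
apply: ge0_subset_integral => //; exact/measurable_EFinP.
Qed.

(** The block of [cusp_integral_ge] is closed and the cusp is open: its height is
taken at [r/8], strictly to the left of its left side [x = r/4]. *)
Lemma cusp_block m r (x y : R) : 0 < m -> 0 < r ->
  rect (r / 4) (r / 2) (- (r / 8) `^ m) ((r / 8) `^ m) (x, y) ->
  [/\ 0 < x <= r, `|y| < x `^ m & `|y| <= r `^ m].
Proof.
move=> m0 r0 [/=]; rewrite !in_itv /= -ler_norml => xr ys.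
have xr1 : 0 < x <= r by lra.
have yx : `|y| < x `^ m.
  apply: le_lt_trans ys _; apply: gt0_ltr_powR => //; rewrite ?nnegrE; lra.
split => //; rewrite (le_trans (ltW yx))//.
case/andP: xr1 => x0 xr1; by apply: ge0_ler_powR => //;
  rewrite ?nnegrE// ltW.
Qed.

Lemma cusp_tipE O m (delta r x y : R) :
  O `&` disc0 delta =
    [set z | 0 < z.1 /\ `|z.2| < z.1 `^ m] `&` disc0 delta ->
  2 * r < delta -> `|x| <= r -> `|y| <= r ->
  O (x, y) <-> 0 < x /\ `|y| < x `^ m.
Proof.
move=> cusp rdelta xr yr; have dxy := disc0_square xr yr rdelta.
split=> [Oxy|cxy].
- have : (O `&` disc0 delta) (x, y) by [].
  by rewrite cusp => -[].
- suff : (O `&` disc0 delta) (x, y) by case.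
  by rewrite cusp.
Qed.

Lemma small_radius (a b d : R) : 0 < a -> 0 < b -> 0 < d ->
  exists r, [/\ 0 < r, r <= 1, 2 * r < a, 2 * r < b & 2 * r < d].
Proof.
move=> a0 b0 d0; exists (Num.min 1 (Num.min (a / 3) (Num.min (b / 3) (d / 3)))).
set q := Num.min _ _.
have q0 : 0 < q by rewrite !lt_min ltr01 !divr_gt0.
have : q <= q by []; rewrite {2}/q !le_min => /and4P[q1 q2 q3 q4].
by split => //; lra.
Qed.

Lemma quotient_near_ge (a b c : R) :
  0 < b -> `|a / b - c| <= c / 2 -> c / 2 * b <= a.
Proof. by move=> b0; rewrite -ler_pdivlMr// ler_norml; lra. Qed.

End Cusp.

(** * Non-existence *)

Theorem mainTheorem1 (R : realType) (p m alpha : R) (Omega : set (R * R))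
    (f : R * R -> R)
    (p_gt1 : 1 < p) (m_gt1 : 1 < m)
    (Omega_domain : is_domain Omega) (Omega_bounded : bounded_set Omega)
    (Omega_cusp : exists2 delta : R, 0 < delta &
       Omega `&` disc0 delta =
       [set z | 0 < z.1 /\ `|z.2| < z.1 `^ m] `&` disc0 delta)
    (alpha_itv : alpha \in `](- m - 1) / p, (- m - 1) / p + m - 1])
    (f_Lp : Lp_mean0 Omega p f)
    (f_asymp : asymp_origin Omega f (fun x => x `^ alpha)) :
  ~ exists u : W1p Omega p * W1p Omega p,
      [/\ W1p0 u.1, W1p0 u.2 &
          {ae leb2, forall z, Omega z -> divergence u z = f z}].
Proof.
case=> u [u10 u20 divu].
have [delta delta0 cusp] := Omega_cusp.
have [_ oO _] := Omega_domain.
have [[mf ffin] _] := f_Lp.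
have [c c0 /(_ (c / 2)) [|eta eta0 f_near]] := f_asymp.
  by rewrite divr_gt0.
have alpha_le : alpha <= (- m - 1) / p + m - 1.
  by move: alpha_itv; rewrite in_itv /= => /andP[].
have p0 : 0 < p by exact: lt_trans p_gt1.
have m0 : 0 < m by exact: lt_trans m_gt1.
have mO : measurable (Omega : set (plane R)) := open_plane_measurable oO.
(* C0 is the constant of [cusp_integral_ge]. *)
pose C0 := c / 2 * 4^-1 `^ `|alpha| * 8^-1 `^ m / 4.
have C00 : 0 < C0 by rewrite !mulr_gt0 ?powR_gt0.
have C04 : 0 < C0 / 4 := divr_gt0 C00 (ltr0n _ 4).
have [d d0 small] := Lp_norm_abs_continuous p0 mO (W1p_dy_Lp u.1) C04.
have [r [r0 r1 rdelta reta rd]] := small_radius delta0 eta0 d0.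
pose h := r `^ m.
have h0 : 0 < h by exact: powR_gt0.
have hr : h <= r by apply: ge1r_powR; rewrite ?r0// ltW.
have cuspE x y : `|x| <= r -> `|y| <= h ->
    Omega (x, y) <-> 0 < x /\ `|y| < x `^ m.
  by move=> xr yh; apply: (cusp_tipE cusp rdelta) => //; exact: le_trans hr.
have Oh x y : 0 <= x <= r -> `|y| = h -> ~ Omega (x, y).
  move=> /andP[x0 xr] yh; rewrite cuspE ?yh//; last by rewrite ger0_norm.
  move=> [_]; apply/negP; rewrite -leNgt.
  by apply: ge0_ler_powR; rewrite ?nnegrE// ltW.
have O0 y : `|y| <= h -> ~ Omega (0, y).
  move=> yh Oy; have r00 : `|0 : R| <= r by rewrite normr0 ltW.
  by have [] := (cuspE 0 y r00 yh).1 Oy; rewrite ltxx.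
have := W1p0_rect_identity p_gt1 oO r0 h0 Oh O0 u10 u20.
set D : set (plane R) := _ `&` Omega => ident.
have mD : measurable D by apply: measurableI => //; exact: rect_measurable.
have DO : D `<=` Omega by move=> z [].
have DR : D `<=` rect 0 r (- h) h by move=> z [].
have DV := leb2_sub_rect (ltW r0) (ltW h0) mD DR.
have Dd : (leb2 D < d%:E)%E.
  rewrite (le_lt_trans DV)// lte_fin (le_lt_trans _ rd)// ler_pM2l//.
  by rewrite ler_piMr ?(le_trans hr)// ltW.
have Dz z : D z -> [/\ 0 < z.1, `|z.1| <= r & `|z.2| <= h].
  case: z => x y Dxy; have yh := rect_ordinate_le (DR _ Dxy).
  have [[/= + _] _] := Dxy; rewrite in_itv /= => /andP[x0 xr].
  have xr' : `|x| <= r by rewrite ger0_norm.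
  by have [? _] := (cuspE x y xr' yh).1 (DO _ Dxy).
have mw1 := @measurable_right_gap R D r; have mw2 := @measurable_ordinate R D.
have w1 z : D z -> `|r - z.1| <= r by move=> /DR/rect_right_gap_le.
have w2 z : D z -> `|z.2| <= h by move=> /DR/rect_ordinate_le.
have mfD : measurable_fun D (f : plane R -> R) by exact: measurable_funS mf.
have [mg gfin] := W1p_dy_Lp u.1.
have mgD : measurable_fun D (W1p_dy u.1 : plane R -> R).
  exact: measurable_funS mg.
have if1 : leb2.-integrable D (EFin \o (fun z => (r - z.1) * f z)).
  apply: (bounded_weight_integrable p_gt1 mD mfD mw1 (ltW r0) w1 DV).
  exact: le_lt_trans (Lp_norm_subset p0 mD mO DO mf) ffin.
have ig2 : leb2.-integrable D (EFin \o (fun z => z.2 * W1p_dy u.1 z)).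
  apply: (bounded_weight_integrable p_gt1 mD mgD mw2 (ltW h0) w2 DV).
  exact: le_lt_trans (Lp_norm_subset p0 mD mO DO mg) gfin.
have sum0 : (\int[leb2]_(z in D) ((r - z.1) * f z)%:E +
             \int[leb2]_(z in D) (z.2 * W1p_dy u.1 z)%:E = 0)%E.
  rewrite -ident -(integralD mD if1 ig2); apply: ae_eq_integral => //.
  - exact: measurable_int (integrableD mD if1 ig2).
  - apply/measurable_EFinP.
    apply: measurable_funD; apply: measurable_funM => //.
    apply: measurable_funD => //; apply: measurable_funS DO _ => //.
    + by have [] := W1p_dx_Lp u.1.
    + by have [] := W1p_dy_Lp u.2.
  apply: (@filterS _ _ (ae_filter_ringOfSetsType leb2) _ _ _ divu).
  by move=> z divz Dz' /=; rewrite -EFinD divz//; exact: DO.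
set P := r `^ 2 * r `^ alpha * r `^ m.
have lower : ((C0 * P)%:E <= \int[leb2]_(z in D) ((r - z.1) * f z)%:E)%E.
  apply: cusp_integral_ge => //; first by rewrite divr_gt0.
  - move=> [x y] Sxy; have [/andP[x0 xr] yx yh] := cusp_block m0 r0 Sxy.
    have nxr : `|x| <= r by rewrite gtr0_norm.
    split; last exact: (cuspE x y nxr yh).2 (conj x0 yx).
    by split; rewrite /= in_itv /= ?(ltW x0)// -ler_norml.
  - move=> z /DR[/= + _]; rewrite in_itv /= => /andP[_].
    by rewrite subr_ge0.
  - apply: (@filterS _ _ (ae_filter_ringOfSetsType leb2) _ _ _ f_near).
    move=> z fz Dz'; have [z0 zr zh] := Dz _ Dz'.
    apply: quotient_near_ge; first exact: powR_gt0.
    apply: fz; split; first exact: DO.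
    rewrite (surjective_pairing z).
    by apply: disc0_square reta => //; exact: le_trans hr.
have upper : (\int[leb2]_(z in D) `|z.2 * W1p_dy u.1 z|%:E <=
    (h * (2 * (r * h)) `^ (1 - p^-1))%:E * (C0 / 4)%:E)%E.
  apply: le_trans (holder_bounded_weight p_gt1 mD mgD mw2 (ltW h0) w2 DV) _.
  rewrite lee_wpmul2l ?lee_fin ?mulr_ge0 ?powR_ge0//.
  exact: small.
have P0 : 0 < C0 * P by rewrite !mulr_gt0 ?powR_gt0.
have expo : h * (2 * (r * h)) `^ (1 - p^-1) * (C0 / 4) <= 2 * P * (C0 / 4).
  rewrite (ler_pM2r C04).
  by apply: cusp_exponents => //; rewrite r0.
have absI2 :=
  le_trans (le_abse_integral leb2 mD (measurable_int _ ig2)) upper.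
have F1 := integrable_fin_num mD if1; have F2 := integrable_fin_num mD ig2.
(* C0 * P <= I1 = - I2 <= 2 * P * (C0 / 4) *)
move: lower absI2 sum0 P0 expo; rewrite -(fineK F1) -(fineK F2).
move: (fine _) (fine _) (h * _) => I2 I1 k; clear.
rewrite -EFinM -EFinD !lee_fin => lower absI2 [sum0] P0 expo.
have : I1 <= `|I2| by rewrite -normrN (_ : I1 = - I2) ?ler_norm//; lra.
lra.
Qed.
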